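(* Let $n\ge2$, $f_0\in\mathbb{R}$, $g\in\mathbb{R}^n$, $H\in\mathbb{R}^{n\times n}$ symmetric, $t\in\mathbb{R}^n$, $\sigma>0$, and $$m_{ST}(s)=f_0+g^Ts+\tfrac12 s^THs+\tfrac16(t^Ts)\|s\|^2+\tfrac{\sigma}{4}\|s\|^4,\qquad s\in\mathbb{R}^n.$$ If $s^*$ is a global minimizer of $m_{ST}$, then $q(v)=m_{ST}(s^*+v)-m_{ST}(s^* )$ is a sum of squares of polynomials in $v$.
   Context: $\|\cdot\|$ is the Euclidean norm on $\mathbb{R}^n$. The cubic term corresponds to the symmetric tensor $T$ with $T[s]^3=(t^Ts)\|s\|^2$ for all $s\in\mathbb{R}^n$. *)

(* Defs.v *)
From mathcomp Require Import all_boot all_order all_algebra.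
From mathcomp Require Import reals mpoly.

Set Implicit Arguments.
Unset Strict Implicit.
Unset Printing Implicit Defensive.

Import Order.TTheory GRing.Theory Num.Theory.

Local Open Scope ring_scope.

(* The norm `|s| that the libraries put on matrices is the sup norm, hence
   an explicit Euclidean norm. *)
Definition enorm (R : realType) (n : nat) (s : 'cV[R]_n) : R :=
  Num.sqrt (\sum_(i < n) s i 0 ^+ 2).

Definition m_ST (R : realType) (n : nat) (f0 : R) (g : 'cV[R]_n)
    (H : 'M[R]_n) (t : 'cV[R]_n) (sigma : R) (s : 'cV[R]_n) : R :=
  f0 + (g^T *m s) 0 0 + 2^-1 * (s^T *m H *m s) 0 0
  + 6^-1 * (t^T *m s) 0 0 * enorm s ^+ 2 + sigma / 4 * enorm s ^+ 4.

Definition global_minimizer (R : realType) (n : nat) (f : 'cV[R]_n -> R)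
    (x : 'cV[R]_n) : Prop :=
  forall y : 'cV[R]_n, f x <= f y.

(* The coordinates of the column vector v are the values of the variables. *)
Definition is_sos (R : realType) (n : nat) (q : 'cV[R]_n -> R) : Prop :=
  exists ps : seq {mpoly R[n]},
    forall v : 'cV[R]_n, q v = \sum_(p <- ps) p.@[fun i => v i 0] ^+ 2.

(* Main.v *)
Require Import Defs.
From mathcomp Require Import all_boot all_order all_algebra.
From mathcomp Require Import reals mpoly.
From mathcomp Require Import ring lra.

(** Translating a global minimizer to the origin leaves a polynomial
      q v = l.v + v^T A v + (c.v) |v|^2 + d |v|^4,   d = sigma / 4 > 0,
    that is nonnegative on the whole space; its cubic and quartic parts are
    multiples of |v|^2, and this is what makes nonnegativity and being a sum
    of squares coincide.  Indeed, the square in |v|^2 can be completed: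
      q v = l.v + d (|v|^2 + (c.v) / (2 d))^2 + v^T B v,
      B = A - (4 d)^-1 c c^T.
    On the line spanned by v, q is a univariate quartic
      x |-> x (l.v) + x^2 (v^T A v) + x^3 (c.v) |v|^2 + x^4 d |v|^4,
    which is nonnegative and vanishes at 0.  Hence l.v = 0, and the remaining
    factor, quadratic in x, has nonpositive discriminant
    ([quartic_ge0_linear], [quartic_ge0_disc]).  The discriminant inequality
    reads (c.v)^2 <= 4 d (v^T A v), that is, v^T B v >= 0.  A positive
    semidefinite quadratic form is a sum of squares of linear forms
    ([psd_is_sos]), so q is a sum of squares ([ge0_quartic_is_sos]). *)

Set Implicit Arguments.
Unset Strict Implicit.
Unset Printing Implicit Defensive.

Import Order.TTheory GRing.Theory Num.Theory.

Local Open Scope ring_scope.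

(** * The Euclidean inner product *)

Definition dot (R : realType) (n : nat) (u v : 'cV[R]_n) : R :=
  (u^T *m v) 0 0.

Section Dot.
Context {R : realType} {n : nat}.
Implicit Types (u v w : 'cV[R]_n) (A B : 'M[R]_n).

Lemma dotE u v : dot u v = \sum_i u i 0 * v i 0.
Proof. by rewrite /dot mxE; apply: eq_bigr => i _; rewrite mxE. Qed.

Lemma dotC u v : dot u v = dot v u.
Proof. by rewrite !dotE; apply: eq_bigr => i _; rewrite mulrC. Qed.

Lemma dotDr u v w : dot u (v + w) = dot u v + dot u w.
Proof. by rewrite /dot mulmxDr mxE. Qed.

Lemma dotZr a u v : dot u (a *: v) = a * dot u v.
Proof. by rewrite /dot -scalemxAr mxE. Qed.

Lemma dotNr u v : dot u (- v) = - dot u v.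
Proof. by rewrite /dot mulmxN mxE. Qed.

Lemma dotDl u v w : dot (v + w) u = dot v u + dot w u.
Proof. by rewrite dotC dotDr !(dotC u). Qed.

Lemma dotZl a u v : dot (a *: v) u = a * dot v u.
Proof. by rewrite dotC dotZr dotC. Qed.

Lemma dotNl u v : dot (- v) u = - dot v u.
Proof. by rewrite dotC dotNr dotC. Qed.

Lemma dot0r u : dot u 0 = 0.
Proof. by rewrite /dot mulmx0 mxE. Qed.

Lemma dot_mulmx_sym A u v : A^T = A -> dot u (A *m v) = dot v (A *m u).
Proof.
by move=> symA; rewrite dotC /dot trmx_mul symA mulmxA.
Qed.

Lemma dot_outer u v w x : dot u (v *m w^T *m x) = dot u v * dot w x.
Proof.
rewrite /dot -mulmxA.
by rewrite {1}[w^T *m x]mx11_scalar mul_mx_scalar -scalemxAr mxE mulrC.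
Qed.

Lemma dot_eq0 v : dot v v = 0 -> v = 0.
Proof.
rewrite dotE => /eqP; rewrite psumr_eq0 => [/allP v0|i _]; last first.
  by rewrite -expr2 sqr_ge0.
apply/colP => i; rewrite mxE; apply/eqP.
by have := v0 i (mem_index_enum i); rewrite /= mulf_eq0 orbb.
Qed.

Lemma enorm_sqr v : enorm v ^+ 2 = dot v v.
Proof.
rewrite /enorm sqr_sqrtr; last by rewrite sumr_ge0 // => i _; rewrite sqr_ge0.
by rewrite dotE; apply: eq_bigr => i _; rewrite expr2.
Qed.

Lemma dot_delta (i : 'I_n) v : dot (delta_mx i 0) v = v i 0.
Proof. by rewrite /dot trmx_delta -rowE mxE. Qed.

Lemma dot_delta_mulmx A (i j : 'I_n) :
  dot (delta_mx i 0) (A *m delta_mx j 0) = A i j.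
Proof. by rewrite dot_delta -colE mxE. Qed.

End Dot.

(** * Positive semidefinite forms are sums of squares *)

Section SumsOfSquares.
Context {R : realType} {n : nat}.
Implicit Types (f g : 'cV[R]_n -> R) (B : 'M[R]_n).

Lemma eq_is_sos f g : f =1 g -> is_sos f -> is_sos g.
Proof. by move=> fg [ps E]; exists ps => v; rewrite -fg. Qed.

Lemma is_sos0 : is_sos (fun _ : 'cV[R]_n => 0).
Proof. by exists [::] => v; rewrite big_nil. Qed.

Lemma is_sosD f g : is_sos f -> is_sos g -> is_sos (fun v => f v + g v).
Proof. by move=> [p Ep] [q Eq]; exists (p ++ q) => v; rewrite big_cat Ep Eq. Qed.

Lemma is_sos_sqr (a : R) (p : {mpoly R[n]}) f : 0 <= a ->
  (forall v : 'cV[R]_n, p.@[fun i => v i 0] = f v) -> is_sos (fun v => a * f v ^+ 2).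
Proof.
move=> a0 pE; exists [:: Num.sqrt a *: p] => v.
by rewrite big_seq1 mevalZ exprMn sqr_sqrtr // pE.
Qed.

Definition linear_mpoly (c : 'cV[R]_n) : {mpoly R[n]} :=
  \sum_i c i 0 *: 'X_i.

Lemma linear_mpolyE c (v : 'cV[R]_n) :
  (linear_mpoly c).@[fun i => v i 0] = dot c v.
Proof.
rewrite /linear_mpoly raddf_sum dotE; apply: eq_bigr => i _.
by rewrite /= mevalZ mevalXU.
Qed.

Definition sqnorm_mpoly : {mpoly R[n]} := \sum_i 'X_i ^+ 2.

Lemma sqnorm_mpolyE (v : 'cV[R]_n) :
  sqnorm_mpoly.@[fun i => v i 0] = dot v v.
Proof.
rewrite /sqnorm_mpoly raddf_sum dotE; apply: eq_bigr => i _.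
by rewrite /= rmorphXn /= mevalXU expr2.
Qed.

Definition psd B := forall v : 'cV[R]_n, 0 <= dot v (B *m v).

(** Evaluating the form at e_i + x e_j leaves x times 2 B_ij, whose sign
    would change with x. *)
Lemma psd_diag0 B : B^T = B -> psd B -> (forall i, B i i = 0) -> B = 0.
Proof.
move=> symB psdB B0; apply/matrixP => i j; rewrite mxE.
have BE x : 0 <= 2 * x * B i j.
  have := psdB (delta_mx i 0 + x *: delta_mx j 0).
  rewrite mulmxDr -scalemxAr !(dotDr, dotDl, dotZr, dotZl) !dot_delta_mulmx.
  have -> : B j i = B i j by rewrite -{1}symB mxE.
  by rewrite !B0; congr (_ <= _); ring.
have := BE 1; have := BE (-1); lra.
Qed.

(** The value of the new form at v is the minimum of the old one on the line
    v + R e_i, attained at the point where the i-th coordinate of the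
    gradient vanishes. *)
Lemma psd_eliminate B i : B^T = B -> psd B -> 0 < B i i ->
  psd (B - (B i i)^-1 *: (col i B *m (col i B)^T)).
Proof.
move=> symB psdB Bi v.
have := psdB (v - (dot (col i B) v / B i i) *: delta_mx i 0).
rewrite mulmxBr -scalemxAr mulmxBl -scalemxAl.
rewrite !(dotDr, dotDl, dotNr, dotNl, dotZr, dotZl) dot_outer dot_delta_mulmx.
rewrite (dot_mulmx_sym (delta_mx i 0) v symB) -colE (dotC v (col i B)).
by congr (_ <= _); field; rewrite gt_eqF.
Qed.

(** Lagrange's reduction: subtracting the square of the i-th row, suitably
    scaled, cancels the i-th diagonal entry.  A vanishing diagonal entry
    stays so, since the reduction cannot increase it and it remains
    nonnegative; hence the number of nonzero diagonal entries decreases. *)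
Lemma psd_is_sos B : B^T = B -> psd B -> is_sos (fun v => dot v (B *m v)).
Proof.
have [k] := ubnP #|[set i | B i i != 0]|.
elim: k B => // k IH B lek symB psdB.
have [i Bi|B0] := pickP (fun i => B i i != 0); last first.
  apply: eq_is_sos is_sos0 => v.
  by rewrite (psd_diag0 symB psdB) ?mul0mx ?dot0r // => i; apply/eqP/negbFE/B0.
have Bi_gt0 : 0 < B i i.
  by rewrite lt_neqAle eq_sym Bi -dot_delta_mulmx psdB.
set b := col i B; set B' := B - (B i i)^-1 *: (b *m b^T).
have psdB' : psd B' by apply: psd_eliminate.
have symB' : B'^T = B'.
  by rewrite /B' linearB linearZ /= trmx_mul trmxK symB.
have B'E j : B' j j = B j j - (B i i)^-1 * B j i ^+ 2.
  by rewrite !mxE big_ord1 !mxE expr2.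
apply: (@eq_is_sos (fun v => dot v (B' *m v) + (B i i)^-1 * dot b v ^+ 2)).
  move=> v; rewrite /B' mulmxBl -scalemxAl dotDr dotNr dotZr dot_outer.
  by rewrite (dotC v b) expr2 subrK.
apply: is_sosD; last first.
  by apply: is_sos_sqr (linear_mpolyE b); rewrite invr_ge0 ltW.
apply: IH => //; rewrite ltnS in lek; apply: leq_trans lek.
apply: proper_card; apply/properP; split.
  apply/subsetP => j; rewrite !inE; apply: contra => /eqP Bj0.
  rewrite eq_le -{2}dot_delta_mulmx psdB' andbT B'E Bj0 sub0r oppr_le0.
  by rewrite mulr_ge0 ?sqr_ge0 // invr_ge0 ltW.
exists i; rewrite !inE // B'E negbK expr2 mulrA mulVf // mul1r subrr //.
Qed.

End SumsOfSquares.

(** * Nonnegative univariate quartics vanishing at 0 *)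

Section UnivariateQuartic.
Context {R : realFieldType}.
Implicit Types a b c d : R.

(** A nonzero linear coefficient a makes the quartic negative at x = - a y
    for small y > 0, where - a^2 y dominates the other terms. *)
Lemma quartic_ge0_linear a b c d : 0 <= d ->
  (forall x, 0 <= x * a + x ^+ 2 * b + x ^+ 3 * c + x ^+ 4 * d) -> a = 0.
Proof.
move=> d0 q0; apply/eqP/negP => /negP a0.
have a2 : 0 < a ^+ 2 by rewrite lt_neqAle sqr_ge0 eq_sym sqrf_eq0 a0.
set K := 1 + `|b| + `|c * a| + d * a ^+ 2.
have da2 : 0 <= d * a ^+ 2 by rewrite mulr_ge0 // ltW.
have nb := normr_ge0 b; have nc := normr_ge0 (c * a).
have K1 : 1 <= K by rewrite /K; lra.
have K0 : 0 < K by lra.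
set y := K^-1.
have y0 : 0 < y by rewrite invr_gt0.
have y1 : y <= 1 by rewrite invf_le1.
have yK : y * K = 1 by rewrite mulVf ?gt_eqF.
have := q0 (- a * y).
have -> : - a * y * a + (- a * y) ^+ 2 * b + (- a * y) ^+ 3 * c
    + (- a * y) ^+ 4 * d
  = (a ^+ 2 * y) * (- 1 + y * b - y ^+ 2 * (c * a) + y ^+ 3 * (d * a ^+ 2)).
  by ring.
rewrite pmulr_rge0; last exact: mulr_gt0.
have y2 : y ^+ 2 <= y by rewrite expr2 ger_pMl.
have y3 : y ^+ 3 <= y by rewrite exprS ger_pMr // exprn_ile1 // ltW.
have h1 : y * b <= y * `|b| by rewrite ler_pM2l // ler_norm.
have h2 : - (y ^+ 2 * (c * a)) <= y * `|c * a|.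
  rewrite -mulrN; apply: (@le_trans _ _ (y ^+ 2 * `|c * a|)).
    by rewrite ler_wpM2l ?sqr_ge0 // -normrN ler_norm.
  by rewrite ler_wpM2r.
have h3 : y ^+ 3 * (d * a ^+ 2) <= y * (d * a ^+ 2) by rewrite ler_wpM2r.
have : y * 1 + y * `|b| + y * `|c * a| + y * (d * a ^+ 2) = 1.
  by rewrite -[RHS]yK /K; ring.
lra.
Qed.

(** Away from 0 the quadratic factor b + c x + d x^2 is nonnegative.  Its
    minimum is attained at x = - c / (2 d); if that is 0, so that c = 0, a
    negative b is refuted at a small nonzero x. *)
Lemma quartic_ge0_disc b c d : 0 < d ->
  (forall x, 0 <= x ^+ 2 * b + x ^+ 3 * c + x ^+ 4 * d) ->
  c ^+ 2 <= 4 * b * d.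
Proof.
move=> d0 q0.
have q0' x : x != 0 -> 0 <= b + x * c + x ^+ 2 * d.
  move=> x0; have x2 : 0 < x ^+ 2 by rewrite lt_neqAle sqr_ge0 eq_sym sqrf_eq0 x0.
  rewrite -(pmulr_rge0 _ x2); have := q0 x; congr (_ <= _); ring.
have [c0|c0] := eqVneq c 0.
  suff b0 : 0 <= b by rewrite c0 expr0n /= !mulr_ge0 // ltW.
  rewrite leNgt; apply/negP => b0.
  have bd0 : 0 < d - b by lra.
  (* then 0 < x < 1 and d x < - b, hence d x^2 < - b as well *)
  pose x := - b / (d - b).
  have x0 : 0 < x by rewrite divr_gt0 // oppr_gt0.
  have xE : x * (d - b) = - b by rewrite divfK ?gt_eqF.
  have x1 : x < 1 by rewrite ltr_pdivrMr //; lra.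
  have := q0' x; rewrite gt_eqF // c0 => /(_ isT).
  nra.
have d0' : d != 0 by rewrite gt_eqF.
have := q0' (- c / (2 * d)).
rewrite mulf_neq0 ?oppr_eq0 ?invr_eq0 ?mulf_neq0 ?pnatr_eq0 // => /(_ isT).
have -> : b + - c / (2 * d) * c + (- c / (2 * d)) ^+ 2 * d
   = (4 * b * d - c ^+ 2) / (4 * d) by field.
by rewrite pmulr_lge0 ?invr_gt0 ?mulr_gt0 // subr_ge0.
Qed.

End UnivariateQuartic.

(** * Quartics whose higher-order part is divisible by the squared norm *)

Section SpecialQuartic.
Context {R : realType} {n : nat}.

(** For v != 0 the discriminant inequality along the line of v carries the
    factor |v|^4 on both sides; cancelling it leaves a condition that is
    homogeneous quadratic in v, namely that B is positive semidefinite. *)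
Lemma ge0_quartic_is_sos (l c : 'cV[R]_n) (A : 'M[R]_n) (d : R) :
  A^T = A -> 0 < d ->
  let q v := dot l v + dot v (A *m v) + dot c v * dot v v + d * dot v v ^+ 2 in
  (forall v, 0 <= q v) -> is_sos q.
Proof.
move=> symA d0 q q0.
have qline v x : q (x *: v) = x * dot l v + x ^+ 2 * dot v (A *m v)
    + x ^+ 3 * (dot c v * dot v v) + x ^+ 4 * (d * dot v v ^+ 2).
  by rewrite /q -scalemxAr !(dotZr, dotZl); ring.
have l0 v : dot l v = 0.
  apply: (@quartic_ge0_linear _ _ (dot v (A *m v)) (dot c v * dot v v)
    (d * dot v v ^+ 2)); first by rewrite mulr_ge0 ?sqr_ge0 // ltW.
  by move=> x; rewrite -qline.
have d0' : d != 0 by rewrite gt_eqF.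
set B := A - (4 * d)^-1 *: (c *m c^T).
have BE v : dot v (B *m v) = dot v (A *m v) - (4 * d)^-1 * dot c v ^+ 2.
  by rewrite mulmxBl -scalemxAl dotDr dotNr dotZr dot_outer (dotC v c) expr2.
have symB : B^T = B by rewrite /B linearB linearZ /= trmx_mul trmxK symA.
have psdB : psd B.
  move=> v; have [/dot_eq0 ->|v0] := eqVneq (dot v v) 0.
    by rewrite mulmx0 dot0r.
  have v2 : 0 < dot v v ^+ 2 by rewrite lt_neqAle sqr_ge0 eq_sym sqrf_eq0 v0.
  have : (dot c v * dot v v) ^+ 2 <= 4 * dot v (A *m v) * (d * dot v v ^+ 2).
    apply: quartic_ge0_disc => [|x]; first by rewrite mulr_gt0.
    by have := q0 (x *: v); rewrite qline l0 mulr0 add0r.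
  rewrite exprMn [leRHS]mulrA ler_pM2r // BE subr_ge0 => cA.
  rewrite mulrC ler_pdivrMr ?mulr_gt0 //; apply: le_trans cA _.
  by rewrite le_eqVlt; apply/orP; left; apply/eqP; ring.
apply: (@eq_is_sos _ _ (fun v => dot v (B *m v)
    + d * (dot v v + dot ((2 * d)^-1 *: c) v) ^+ 2)).
  by move=> v; rewrite /q BE l0 dotZl; field.
apply: is_sosD; first exact: psd_is_sos.
apply: (@is_sos_sqr _ _ _ (sqnorm_mpoly + linear_mpoly ((2 * d)^-1 *: c)));
  first exact: ltW.
by move=> v; rewrite mevalD sqnorm_mpolyE linear_mpolyE.
Qed.

Lemma m_STE f0 (g : 'cV[R]_n) H t sigma s :
  m_ST f0 g H t sigma s = f0 + dot g s + 2^-1 * dot s (H *m s)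
    + 6^-1 * dot t s * dot s s + sigma / 4 * dot s s ^+ 2.
Proof. by rewrite /m_ST -!enorm_sqr -exprM -mulmxA. Qed.

(** Expansion at s; the gradient at s is the vector in front of v, and the
    cubic part keeps the shape (c.v) |v|^2 because the quartic term
    contributes sigma (s.v) |v|^2 to it. *)
Lemma m_ST_shift f0 (g : 'cV[R]_n) H t sigma s v : H^T = H ->
  m_ST f0 g H t sigma (s + v) - m_ST f0 g H t sigma s =
    dot (g + H *m s + (6^-1 * dot s s) *: t
         + (3^-1 * dot t s + sigma * dot s s) *: s) v
    + dot v ((2^-1 *: H + (6^-1 * dot t s + sigma / 2 * dot s s)%:M
              + 6^-1 *: (t *m s^T + s *m t^T) + sigma *: (s *m s^T)) *m v)
    + dot (6^-1 *: t + sigma *: s) v * dot v v + sigma / 4 * dot v v ^+ 2.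
Proof.
move=> symH; rewrite !m_STE !mulmxDr !mulmxDl -!scalemxAl mulmxDl mul_scalar_mx.
rewrite !(dotDr, dotDl, dotZr, dotZl) !dot_outer.
rewrite (dot_mulmx_sym s v symH) (dotC (H *m s)) (dotC v s) (dotC v t).
by field.
Qed.

End SpecialQuartic.

Theorem theorem3p2 (R : realType) (n : nat) (hn : (2 <= n)%N)
    (f0 : R) (g : 'cV[R]_n) (H : 'M[R]_n) (hH : H^T = H) (t : 'cV[R]_n)
    (sigma : R) (hsigma : 0 < sigma) (sstar : 'cV[R]_n)
    (hmin : global_minimizer (m_ST f0 g H t sigma) sstar) :
  is_sos (fun v : 'cV[R]_n =>
    m_ST f0 g H t sigma (sstar + v) - m_ST f0 g H t sigma sstar).
Proof.
have shift v := m_ST_shift f0 g t sigma sstar v hH.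
apply: eq_is_sos (fun v => esym (shift v)) _.
apply: ge0_quartic_is_sos => [||v].
- rewrite !linearD /= !linearZ /= !trmx_mul !trmxK hH tr_scalar_mx.
  by rewrite [X in _ + X + _ = _]addrC.
- by rewrite divr_gt0.
- by rewrite -shift subr_ge0.
Qed.
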